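(* Let $q\ge1$ and suppose $\mathsf K\in\mathcal{C}_q$ represents a controllable and observable controller. Then the orbit $\mathcal{O}_{\mathsf K}=\{\mathscr{T}_q(T,\mathsf K)\mid T\in\mathrm{GL}_q\}$ is a submanifold of $\mathcal{C}_q$ of dimension $q^2$, and has two path-connected components, given by $$\mathcal{O}_{\mathsf K}^+=\{\mathscr{T}_q(T,\mathsf K)\mid T\in\mathrm{GL}_q,\ \det T>0\},\qquad \mathcal{O}_{\mathsf K}^-=\{\mathscr{T}_q(T,\mathsf K)\mid T\in\mathrm{GL}_q,\ \det T<0\}.$$
   Context: Fix integers $n,m,p\ge 1$, real matrices $A\in\mathbb{R}^{n\times n}$, $B\in\mathbb{R}^{n\times m}$, $C\in\mathbb{R}^{p\times n}$ (the plant $\dot x=Ax+Bu+w$, $y=Cx+v$), and real symmetric matrices $W\succeq 0$ ($n\times n$), $V\succ 0$ ($p\times p$), $Q\succeq 0$ ($n\times n$), $R\succ 0$ ($m\times m$). Standing assumption: $(A,B)$ and $(A,W^{1/2})$ are controllable, and $(C,A)$ and $(Q^{1/2},A)$ are observable. A real square matrix is called stable if all its eigenvalues have negative real part. $\mathcal{V}_q$ is the linear space of matrices $\mathsf K=\begin{bmatrix}0_{m\times p}&C_{\mathsf K}\\ B_{\mathsf K}&A_{\mathsf K}\end{bmatrix}\in\mathbb{R}^{(m+q)\times(p+q)}$ with $A_{\mathsf K}\in\mathbb{R}^{q\times q}$, $B_{\mathsf K}\in\mathbb{R}^{q\times p}$, $C_{\mathsf K}\in\mathbb{R}^{m\times q}$,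 and $\mathcal{C}_q\subseteq\mathcal{V}_q$ is the (open) subset of those $\mathsf K$ for which $\begin{bmatrix}A&BC_{\mathsf K}\\ B_{\mathsf K}C&A_{\mathsf K}\end{bmatrix}$ is stable. $\mathsf K$ is controllable and observable if $(A_{\mathsf K},B_{\mathsf K})$ is controllable and $(C_{\mathsf K},A_{\mathsf K})$ is observable. $\mathrm{GL}_q$ is the group of invertible real $q\times q$ matrices, and $$\mathscr{T}_q(T,\mathsf K)=\begin{bmatrix}0&C_{\mathsf K}T^{-1}\\ TB_{\mathsf K}&TA_{\mathsf K}T^{-1}\end{bmatrix},\qquad T\in\mathrm{GL}_q,\ \mathsf K\in\mathcal{C}_q.$$ ''Submanifold'' means embedded $C^\infty$ submanifold. *)

(* Defs.v *)
From HB Require Import structures.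
From mathcomp Require Import all_boot all_order all_algebra.
From mathcomp Require Import complex.
From mathcomp Require Import all_classical all_reals all_analysis.
Import Order.TTheory GRing.Theory Num.Theory.
Import numFieldNormedType.Exports.

Set Implicit Arguments.
Unset Strict Implicit.
Unset Printing Implicit Defensive.

Local Open Scope classical_set_scope.
Local Open Scope ring_scope.

Section Smoothness.
Variables (R : realType) (E F : normedModType R).

(* Throughout, [V] is a finite-dimensional linear subspace of [E] and [U] is a
   subset of [V] that is open in the topology of [V]. Since [U] is open in [V],
   the derivative of [f] at a point of [U] along [v] in [V] depends only on the
   restriction of [f] to [U]. As [V] is finite-dimensional, continuity of all
   iterated directional derivatives of order at most [k] is the usual notion of
   class C^k. The usual case of an open subset of [E] is [V := setT]. *)
Definition relatively_open (V U : set E) : Prop :=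
  exists2 O : set E, open O & U = O `&` V.

Fixpoint Ck_on (V U : set E) (k : nat) (f : E -> F) : Prop :=
  {within U, continuous f} /\
  if k is k'.+1 then
    forall v, V v ->
      (forall x, U x -> derivable f x v) /\ Ck_on V U k' (fun x => 'D_v f x)
  else True.

Definition smooth_on (V U : set E) (f : E -> F) : Prop :=
  forall k, Ck_on V U k f.

End Smoothness.

Section Submanifolds.
Variables (R : realType) (E : normedModType R).

Definition smooth_chart (V U : set E) (N : nat)
    (phi : E -> 'rV[R]_N) (psi : 'rV[R]_N -> E) : Prop :=
  [/\ smooth_on V U phi,
      open (phi @` U),
      smooth_on setT (phi @` U) psi &
      forall x, U x -> psi (phi x) = x].

(* [S] is an embedded C^oo submanifold of dimension [d] of the manifold [M],
   where [M] is an open subset of the finite-dimensional linear space [V]: near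
   each of its points [S] is a slice of a smooth chart of [M]. The codimension
   [c] need not be fixed in advance, since the existence of a smooth chart
   forces [d + c] to be the dimension of [V]. *)
Definition embedded_submanifold (V M : set E) (d : nat) (S : set E) : Prop :=
  S `<=` M /\
  forall x, S x ->
    exists (c : nat) (U : set E)
           (phi : E -> 'rV[R]_(d + c)) (psi : 'rV[R]_(d + c) -> E),
      [/\ U x, relatively_open V U, U `<=` M, smooth_chart V U phi psi &
          U `&` S = U `&` [set y | rsubmx (phi y) = 0]].

End Submanifolds.

Section PathComponents.
Variables (R : realType) (T : topologicalType).

Definition joined_in (S : set T) (x y : T) : Prop :=
  exists gamma : R -> T,
    [/\ {within `[0, 1], continuous gamma}, gamma 0 = x, gamma 1 = y &
        forall t, 0 <= t <= 1 -> S (gamma t)].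

Definition path_component_of (S : set T) (x : T) : set T :=
  [set y | joined_in S x y].

Definition path_components (S : set T) : set (set T) :=
  [set path_component_of S x | x in S].

End PathComponents.

Section Systems.
Variable R : realType.

Definition psdmx n (S : 'M[R]_n) : Prop :=
  S^T = S /\ forall x : 'cV[R]_n, 0 <= (x^T *m S *m x) 0 0.

Definition pdmx n (S : 'M[R]_n) : Prop :=
  S^T = S /\ forall x : 'cV[R]_n, x != 0 -> 0 < (x^T *m S *m x) 0 0.

(* The square root S^{1/2} of a positive semidefinite [S] is the unique positive
   semidefinite matrix whose square is [S]; the value is junk for other [S]. *)
Definition sqrtmx n (S : 'M[R]_n) : 'M[R]_n :=
  xget 0 [set X : 'M[R]_n | psdmx X /\ X *m X = S].

(* Kalman matrices: [B, A B, ..., A^(n-1) B] has full row rank for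
   controllability, and its dual has full column rank for observability. *)
Definition controllable n m (A : 'M[R]_n) (B : 'M[R]_(n, m)) : Prop :=
  row_free (\mxrow_(i < n) (A ^+ i *m B)).

Definition observable p n (C : 'M[R]_(p, n)) (A : 'M[R]_n) : Prop :=
  row_full (\mxcol_(i < n) (C *m A ^+ i)).

Definition stable n (A : 'M[R]_n) : Prop :=
  forall z : R[i], eigenvalue (map_mx (real_complex R) A) z -> complex.Re z < 0.

End Systems.

Section Controllers.
Variables (R : realType) (m p q : nat).
Implicit Type K : 'M[R]_(m + q, p + q).

(* A controller is a block matrix [0 C_K; B_K A_K]. *)
Definition ctrlA K : 'M[R]_q := drsubmx K.
Definition ctrlB K : 'M[R]_(q, p) := dlsubmx K.
Definition ctrlC K : 'M[R]_(m, q) := ursubmx K.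

Definition controllers : set 'M[R]_(m + q, p + q) := [set K | ulsubmx K = 0].

Definition closed_loop n (A : 'M[R]_n) (B : 'M[R]_(n, m)) (C : 'M[R]_(p, n)) K
    : 'M[R]_(n + q) :=
  block_mx A (B *m ctrlC K) (ctrlB K *m C) (ctrlA K).

Definition stabilizing n (A : 'M[R]_n) (B : 'M[R]_(n, m)) (C : 'M[R]_(p, n))
    : set 'M[R]_(m + q, p + q) :=
  [set K | controllers K /\ stable (closed_loop A B C K)].

Definition similarity (T : 'M[R]_q) K : 'M[R]_(m + q, p + q) :=
  block_mx 0 (ctrlC K *m invmx T)
           (T *m ctrlB K) (T *m ctrlA K *m invmx T).

Definition orbit_of K : set 'M[R]_(m + q, p + q) :=
  [set similarity T K | T in [set T : 'M[R]_q | T \in unitmx]].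

Definition orbit_pos K : set 'M[R]_(m + q, p + q) :=
  [set similarity T K | T in [set T : 'M[R]_q | T \in unitmx /\ 0 < \det T]].

Definition orbit_neg K : set 'M[R]_(m + q, p + q) :=
  [set similarity T K | T in [set T : 'M[R]_q | T \in unitmx /\ \det T < 0]].

End Controllers.

(* Main.v *)
(** The point is to find a global slice for the action of GL_q. By
    controllability one can pick, Kronecker style, a "nice" selection of columns
    of the Kalman matrix of (A_K, B_K) forming a
    basis E(K) of R^q: each column is either a column of B_K or the A_K-image of
    an earlier one. Then E is polynomial in K and E(T.K) = T E(K), and E(K) = 1
    is an affine condition, namely that q prescribed columns of [B_K A_K] form
    the identity matrix. Hence K |-> (E(K), remaining entries of E(K)^-1 . K) is
    a rational chart, defined near the whole orbit, in which orbits are the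
    fibres of the second component.
    Stability is open because an unstable eigenvalue would lie in a compact
    rectangle, on which |det (A - z)|^2 is bounded away from zero.
    Matrices of positive determinant are products of unitriangular matrices and
    diag(1, ..., 1, d) with d > 0, whence paths to the identity; conversely det E(T.K) is
    det T times a nonzero constant, so the sign of det T is constant along
    paths in the orbit. *)

Require Import Defs.
From HB Require Import structures.
From mathcomp Require Import all_boot all_order all_fingroup all_algebra.
From mathcomp Require Import complex.
From mathcomp Require Import all_classical all_reals all_analysis.
Import Order.TTheory GRing.Theory Num.Theory.
Import numFieldNormedType.Exports.

Set Implicit Arguments.
Unset Strict Implicit.
Unset Printing Implicit Defensive.

Local Open Scope classical_set_scope.
Local Open Scope ring_scope.

(** * Functions of class C^oo with matrix values *)

(** Neighbourhoods of a matrix are generated by finite boxes of entry neighbourhoods, and a filter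
    is closed under finite intersections. *)
Lemma cvg_mx (T : topologicalType) I (F : set_system I) {FF : Filter F} a b
    (M : I -> 'M[T]_(a, b)) (L : 'M[T]_(a, b)) :
  (forall i j, M x i j @[x --> F] --> L i j) -> M @ F --> L.
Proof.
move=> ML A [P LP PA]; apply: (@filterS _ _ _
  (fun x => forall i j, P i j (M x i j))).
  by move=> x Px; exact: PA.
by apply: filter_forall => i; apply: filter_forall => j; exact: ML (LP i j).
Qed.

Section SmoothCalculus.
Variables (R : realType) (E : normedModType R) (V U : set E).
Hypothesis V_lin : forall (h : R) (v x : E), V v -> V x -> V (h *: v + x).
Hypothesis U_open : relatively_open V U.

(** Linearity keeps the line in [V] and openness keeps it in [U] for small [h], so difference
    quotients along [V] see only the restriction of a function to [U]. *)
Lemma near_line x v : U x -> V v -> \forall h \near (0 : R), U (h *: v + x).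
Proof.
case: U_open => W oW -> [Wx Vx] Vv.
have : \forall h \near (0 : R), W (h *: v + x).
  apply: (_ : continuous (fun h : R => h *: v + x)) => [h|].
    by apply: cvgD; [apply: cvgZr_tmp; exact: cvg_id|exact: cvg_cst].
  by rewrite scale0r add0r; exact: open_nbhs_nbhs.
by apply: filterS => h Wh; split=> //; exact: V_lin.
Qed.

Section Extensionality.
Variable F : normedModType R.
Implicit Types f g : E -> F.

Lemma near_quotient f g x v : U x -> V v -> {in U, f =1 g} ->
  {near 0^', (fun h : R => h^-1 *: ((f \o shift x) (h *: v) - f x)) =1
             (fun h : R => h^-1 *: ((g \o shift x) (h *: v) - g x))}.
Proof.
move=> Ux Vv fg.
have : \forall h \near (0 : R)^', U (h *: v + x).
  by apply: nbhs_dnbhs; exact: near_line.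
by apply: filterS => h Uh /=; rewrite !fg ?inE.
Qed.

Lemma derivable_eq_on f g x v : U x -> V v -> {in U, f =1 g} ->
  derivable f x v -> derivable g x v.
Proof.
move=> Ux Vv fg /cvg_ex[l fl]; apply/cvg_ex; exists l.
by apply: cvg_trans fl; apply: near_eq_cvg; exact: near_quotient.
Qed.

Lemma derive_eq_on f g x v : U x -> V v -> {in U, f =1 g} ->
  'D_v f x = 'D_v g x.
Proof.
move=> Ux Vv fg; rewrite /derive; congr (lim _).
by rewrite eqEsubset; split; apply: near_eq_cvg; apply: near_quotient => // y;
  move=> Uy; rewrite fg.
Qed.

(** Closed formulas for derivatives hold only on [U]; this lemma substitutes them in the inductions
    on [k] below. *)
Lemma Ck_on_eq k f g : {in U, f =1 g} -> Ck_on V U k f -> Ck_on V U k g.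
Proof.
elim: k f g => [|k IH] f g fg /= [cf Df]; split => //.
- exact: subspace_eq_continuous cf.
- exact: subspace_eq_continuous cf.
- move=> v Vv; have [df Ckf] := Df v Vv; split.
    by move=> x Ux; apply: derivable_eq_on fg _ => //; exact: df.
  by apply: IH Ckf => x; rewrite inE => Ux; exact: derive_eq_on.
Qed.

Lemma Ck_onW k f : Ck_on V U k.+1 f -> Ck_on V U k f.
Proof.
elim: k f => [|k IH] f [cf Df]; split=> // v Vv.
by have [df Ckf] := Df v Vv; split=> //; exact: IH.
Qed.

Lemma Ck_on_cst k (a : F) : Ck_on V U k (fun=> a).
Proof.
elim: k a => [|k IH] a; split=> //;
  try by apply: continuous_subspaceT; exact: cst_continuous.
move=> v Vv; split=> [x _|]; first exact: derivable_cst.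
have -> : (fun x => 'D_v (fun=> a) x) = (fun=> 0 : F).
  by apply/funext => x; exact: derive_cst.
exact: IH.
Qed.

Lemma Ck_onD k f g : Ck_on V U k f -> Ck_on V U k g ->
  Ck_on V U k (fun x => f x + g x).
Proof.
elim: k f g => [|k IH] f g [cf Df] [cg Dg]; split=> //;
  try by move=> x; apply: cvgD; [exact: cf|exact: cg].
move=> v Vv; have [df Ckf] := Df v Vv; have [dg Ckg] := Dg v Vv; split.
  by move=> x Ux; apply: derivableD; [exact: df|exact: dg].
apply: (@Ck_on_eq _ (fun x => 'D_v f x + 'D_v g x)); last exact: IH.
move=> x /[!inE] Ux; symmetry; apply: deriveD; [exact: df|exact: dg].
Qed.

End Extensionality.

Implicit Types f g : E -> R.

Lemma Ck_onM k f g : Ck_on V U k f -> Ck_on V U k g ->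
  Ck_on V U k (fun x => f x * g x).
Proof.
elim: k f g => [|k IH] f g kf kg; have [cf Df] := kf; have [cg Dg] := kg;
  split=> //; try by move=> x; apply: cvgM; [exact: cf|exact: cg].
move=> v Vv; have [df Ckf] := Df v Vv; have [dg Ckg] := Dg v Vv; split.
  by move=> x Ux; apply: derivableM; [exact: df|exact: dg].
apply: (@Ck_on_eq _ _ (fun x => f x * 'D_v g x + g x * 'D_v f x)); last first.
  by apply: Ck_onD; apply: IH => //; exact: Ck_onW.
move=> x /[!inE] Ux; symmetry; apply: deriveM; [exact: df|exact: dg].
Qed.

Lemma Ck_onV k f : (forall x, U x -> f x != 0) -> Ck_on V U k f ->
  Ck_on V U k (fun x => (f x)^-1).
Proof.
move=> f0; have cfV : {within U, continuous f} ->
    {within U, continuous (fun x => (f x)^-1)}.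
  move=> /subspace_continuousP cf; apply/subspace_continuousP => x Ux.
  by apply: cvgV; [exact: f0|exact: cf].
elim: k => [|k IH] kf; have [cf Df] := kf; split=> //; try exact: cfV.
move=> v Vv; have [df Ckf] := Df v Vv; split.
  by move=> x Ux; apply: derivableV; [exact: f0|exact: df].
(* The derivative of [f^-1] is a product of copies of [f^-1], of class C^k by induction, and of
   ['D_v f]. *)
apply: (@Ck_on_eq _ _ (fun x => -1 * ((f x)^-1 * (f x)^-1) * 'D_v f x)).
  move=> x /[!inE] Ux; rewrite deriveV; [|exact: f0|exact: df].
  by rewrite /GRing.scale/= mulN1r -expr2 exprVn.
have kfV := IH (Ck_onW kf).
by apply: Ck_onM => //; apply: Ck_onM; [exact: Ck_on_cst|exact: Ck_onM].
Qed.

Lemma Ck_on_mx k a b (M : E -> 'M[R]_(a, b)) :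
  (forall i j, Ck_on V U k (fun x => M x i j)) -> Ck_on V U k M.
Proof.
have cM (N : E -> 'M[R]_(a, b)) :
    (forall i j, {within U, continuous (fun x => N x i j)}) ->
    {within U, continuous N}.
  by move=> cN x; apply: cvg_mx => i j; exact: cN.
elim: k M => [|k IH] M kM; split=> //;
  try by apply: cM => i j; have [] := kM i j.
move=> v Vv.
have dM x : U x -> derivable M x v.
  move=> Ux; apply/derivable_mxP => i j.
  by have [_ /(_ v Vv)[dMij _]] := kM i j; exact: dMij.
split=> //; apply: IH => i j.
have [_ /(_ v Vv)[_]] := kM i j; apply: Ck_on_eq => x /[!inE] Ux.
by rewrite derive_mx ?mxE//; exact: dM.
Qed.

Lemma smooth_on_cst (F : normedModType R) (a : F) : smooth_on V U (fun=> a).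
Proof. by move=> k; exact: Ck_on_cst. Qed.

Lemma smooth_onD f g :
  smooth_on V U f -> smooth_on V U g -> smooth_on V U (fun x => f x + g x).
Proof. by move=> sf sg k; exact: Ck_onD. Qed.

Lemma smooth_onM f g :
  smooth_on V U f -> smooth_on V U g -> smooth_on V U (fun x => f x * g x).
Proof. by move=> sf sg k; exact: Ck_onM. Qed.

Lemma smooth_onV f : (forall x, U x -> f x != 0) ->
  smooth_on V U f -> smooth_on V U (fun x => (f x)^-1).
Proof. by move=> f0 sf k; exact: Ck_onV. Qed.

Lemma smooth_on_eq (F : normedModType R) (f g : E -> F) :
  {in U, f =1 g} -> smooth_on V U f -> smooth_on V U g.
Proof. by move=> fg sf k; exact: Ck_on_eq fg _. Qed.

Lemma smooth_on_sum I (r : seq I) (P : pred I) (f : I -> E -> R) :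
  (forall i, smooth_on V U (f i)) ->
  smooth_on V U (fun x => \sum_(i <- r | P i) f i x).
Proof.
move=> sf; elim: r => [|i r IH].
  by under eq_fun do rewrite big_nil; exact: smooth_on_cst.
under eq_fun do rewrite big_cons.
by case: (P i) => //; exact: smooth_onD.
Qed.

Lemma smooth_on_prod I (r : seq I) (P : pred I) (f : I -> E -> R) :
  (forall i, smooth_on V U (f i)) ->
  smooth_on V U (fun x => \prod_(i <- r | P i) f i x).
Proof.
move=> sf; elim: r => [|i r IH].
  by under eq_fun do rewrite big_nil; exact: smooth_on_cst.
under eq_fun do rewrite big_cons.
by case: (P i) => //; exact: smooth_onM.
Qed.

Definition smooth_entries a b (M : E -> 'M[R]_(a, b)) :=
  forall i j, smooth_on V U (fun x => M x i j).

Lemma smooth_on_mx a b (M : E -> 'M[R]_(a, b)) :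
  smooth_entries M -> smooth_on V U M.
Proof. by move=> sM k; apply: Ck_on_mx => i j; exact: sM. Qed.

Lemma smooth_entries_cst a b (A : 'M[R]_(a, b)) : smooth_entries (fun=> A).
Proof. by move=> i j; exact: smooth_on_cst. Qed.

Lemma smooth_entries_mulmx a b c (M : E -> 'M[R]_(a, b))
    (N : E -> 'M[R]_(b, c)) :
  smooth_entries M -> smooth_entries N -> smooth_entries (fun x => M x *m N x).
Proof.
move=> sM sN i j; under eq_fun do rewrite mxE.
by apply: smooth_on_sum => k; exact: smooth_onM.
Qed.

Lemma smooth_entriesD a b (M N : E -> 'M[R]_(a, b)) :
  smooth_entries M -> smooth_entries N -> smooth_entries (fun x => M x + N x).
Proof.
by move=> sM sN i j; under eq_fun do rewrite mxE; exact: smooth_onD.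
Qed.

Lemma smooth_entriesZ a b (f : E -> R) (M : E -> 'M[R]_(a, b)) :
  smooth_on V U f -> smooth_entries M -> smooth_entries (fun x => f x *: M x).
Proof.
by move=> sf sM i j; under eq_fun do rewrite mxE; exact: smooth_onM.
Qed.

Lemma smooth_entries_block a1 a2 b1 b2 (M1 : E -> 'M[R]_(a1, b1))
    (M2 : E -> 'M[R]_(a1, b2)) (M3 : E -> 'M[R]_(a2, b1))
    (M4 : E -> 'M[R]_(a2, b2)) :
  smooth_entries M1 -> smooth_entries M2 -> smooth_entries M3 ->
  smooth_entries M4 ->
  smooth_entries (fun x => block_mx (M1 x) (M2 x) (M3 x) (M4 x)).
Proof.
move=> s1 s2 s3 s4 i j.
case: (split_ordP i) => i' ->; case: (split_ordP j) => j' ->;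
  [under eq_fun do rewrite block_mxEul; exact: s1
  |under eq_fun do rewrite block_mxEur; exact: s2
  |under eq_fun do rewrite block_mxEdl; exact: s3
  |under eq_fun do rewrite block_mxEdr; exact: s4].
Qed.

Lemma smooth_on_det a (M : E -> 'M[R]_a) :
  smooth_entries M -> smooth_on V U (fun x => \det (M x)).
Proof.
move=> sM; apply: smooth_on_sum => s; apply: smooth_onM.
  exact: smooth_on_cst.
by apply: smooth_on_prod => i; exact: sM.
Qed.

Lemma smooth_entries_invmx a (M : E -> 'M[R]_a) :
  (forall x, U x -> M x \in unitmx) ->
  smooth_entries M -> smooth_entries (fun x => invmx (M x)).
Proof.
move=> uM sM i j.
(* Cramer's rule, valid on [U]: both the adjugate and the determinant are polynomial in the
   entries. *)
apply: (@smooth_on_eq _ (fun x => (\det (M x))^-1 * (\adj (M x)) i j)).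
  by move=> x /[!inE] Ux; rewrite /invmx uM// !mxE.
apply: smooth_onM.
  apply: smooth_onV; last exact: smooth_on_det.
  by move=> x Ux; rewrite -unitfE -unitmxE; exact: uM.
under eq_fun do rewrite mxE.
apply: smooth_onM; first exact: smooth_on_cst.
by apply: smooth_on_det => i' j'; under eq_fun do rewrite !mxE; exact: sM.
Qed.

End SmoothCalculus.

(** The derivative along [v] is the constant [f v], so higher orders reduce to constant
    functions. *)
Lemma smooth_on_linear (R : realType) (E F : normedModType R) (V U : set E)
    (f : E -> F) : linear f -> continuous f -> smooth_on V U f.
Proof.
move=> lf cf.
pose g : {linear E -> F} := HB.pack f (GRing.isLinear.Build _ _ _ _ f lf).
have df x : differentiable g x by apply: linear_differentiable; exact: cf.
case=> [|k] /=; (split; first exact: continuous_subspaceT) => //.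
move=> v Vv; split; first by move=> x _; exact: diff_derivable (df x).
have -> : (fun x => 'D_v f x) = (fun=> f v).
  by apply/funext => x; rewrite (deriveE _ (df x)) diff_lin//; exact: cf.
exact: Ck_on_cst.
Qed.

Lemma smooth_entries_id (R : realType) a b (V U : set 'M[R]_(a, b)) :
  smooth_entries V U id.
Proof.
move=> i j; apply: smooth_on_linear; last exact: coord_continuous.
by move=> c x y; rewrite !mxE.
Qed.

Lemma smooth_on_id (R : realType) (V U : set R) : smooth_on V U id.
Proof. by apply: smooth_on_linear => // x; exact: cvg_id. Qed.

Lemma smooth_continuous (R : realType) (E F : normedModType R) (f : E -> F) :
  smooth_on setT setT f -> continuous f.
Proof. by move=> /(_ 0%N)[cf _]; exact/continuous_subspace_setT. Qed.

Lemma relatively_openT (R : realType) (E : normedModType R) (U : set E) :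
  open U -> relatively_open setT U.
Proof. by exists U; rewrite ?setIT. Qed.

Lemma relatively_setT (R : realType) (E : normedModType R) :
  relatively_open setT [set: E].
Proof. by apply: relatively_openT; exact: openT. Qed.
#[local] Hint Resolve relatively_setT : core.

Lemma smooth_on_subset (R : realType) (E F : normedModType R)
    (V U U' : set E) (f : E -> F) :
  U' `<=` U -> smooth_on V U f -> smooth_on V U' f.
Proof.
move=> UU' sf k; elim: k f {sf}(sf k) => [|k IH] f /= [cf Df];
  (split; first exact: continuous_subspaceW cf) => //.
move=> v Vv; have [df Ckf] := Df v Vv.
by split=> [x /UU' Ux|]; [exact: df|exact: IH].
Qed.

(** * Openness of stability *)

Lemma fst_continuous (T S : topologicalType) : continuous (@fst T S).
Proof. by case=> x y; exact: (@cvg_fst _ _ (nbhs x) (nbhs y)). Qed.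

Lemma snd_continuous (T S : topologicalType) : continuous (@snd T S).
Proof. by case=> x y; exact: (@cvg_snd _ _ (nbhs x) (nbhs y)). Qed.

Section Stability.
Variable R : realType.

(* [|det (A - z I)|^2] at [z = a + i b], written over the reals. *)
Definition sqr_charpoly n (A : 'M[R]_n) (a b : R) : R :=
  \det ((A - a%:M) *m (A - a%:M) + (b * b)%:M).

Local Notation toC := (real_complex R).

Lemma eigenvalue_det n (A : 'M[R[i]]_n) z :
  eigenvalue A z = (\det (A - z%:M) == 0).
Proof.
by rewrite /eigenvalue /eigenspace kermx_eq0 row_free_unit unitmxE unitfE negbK.
Qed.

Lemma eigenvalue_sqr_charpoly n (A : 'M[R]_n) (z : R[i]) :
  eigenvalue (map_mx toC A) z =
  (sqr_charpoly A (complex.Re z) (complex.Im z) == 0).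
Proof.
rewrite eigenvalue_det; set M := map_mx toC A; case: z => a b.
(* [M] has real entries, so conjugating the eigenvalue parameter conjugates the determinant. *)
have conjdet : \det (M - (a -i* b)%C%:M) = conjc (\det (M - (a +i* b)%C%:M)).
  rewrite -det_map_mx map_mxB map_scalar_mx /=; congr (\det (_ - _)).
  by apply/matrixP => i j; rewrite !mxE /= oppr0.
(* With [N = M - a] and [w = i b], the factorization is [(N - w)(N + w) = N^2 - w^2 = N^2 + b^2]. *)
have dvd : toC (sqr_charpoly A a b) =
    \det (M - (a +i* b)%C%:M) * \det (M - (a -i* b)%C%:M).
  rewrite -det_mulmx -det_map_mx; congr (\det _).
  rewrite map_mxD map_mxM !map_mxB !map_scalar_mx/= -/M.
  pose w : R[i] := (0 +i* b)%C; set N := M - (toC a)%:M.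
  have -> : (a +i* b)%C%:M = (toC a)%:M + w%:M :> 'M[R[i]]_n.
    by rewrite -raddfD /=; congr (_%:M); apply/eqP;
      rewrite eq_complex/= addr0 add0r !eqxx.
  have -> : (a -i* b)%C%:M = (toC a)%:M - w%:M :> 'M[R[i]]_n.
    by rewrite -raddfB /=; congr (_%:M); apply/eqP;
      rewrite eq_complex/= subr0 sub0r !eqxx.
  have -> : (toC (b * b))%:M = - (w%:M *m w%:M) :> 'M[R[i]]_n.
    rewrite -scalar_mxM -raddfN /=; congr (_%:M); apply/eqP.
    by rewrite eq_complex/= !mulr0 !mul0r sub0r addr0 opprK oppr0 !eqxx.
  have -> : M - ((toC a)%:M + w%:M) = N - w%:M by rewrite opprD addrA.
  have -> : M - ((toC a)%:M - w%:M) = N + w%:M by rewrite opprB addrA addrAC.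
  move: N => N; rewrite mulmxBl !mulmxDr !mul_scalar_mx mul_mx_scalar.
  by rewrite opprD addrA addrK.
rewrite /= -[RHS](fmorph_eq0 toC) /= dvd conjdet mulf_eq0.
by rewrite conjc_eq0 orbb.
Qed.

Lemma normc_real (x : R) : `|toC x| = toC `|x|.
Proof. by rewrite normc_def/= expr0n addr0 sqrtr_sqr. Qed.

(** For a left eigenvector [v], compare the l1 norms of [z v] and [v A]: every row of [A] has l1
    norm at most the total sum of entries. *)
Lemma eigenvalue_bound n (A : 'M[R]_n) (z : R[i]) :
  eigenvalue (map_mx toC A) z -> `|z| <= toC (\sum_i \sum_j `|A i j|).
Proof.
move=> /eigenvalueP[v vA v0].
have vpos : 0 < \sum_j `|v 0 j|.
  rewrite lt_def sumr_ge0 ?andbT//; apply: contra_neq v0 => /eqP.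
  rewrite psumr_eq0// => /allP v0; apply/rowP => j; rewrite mxE.
  apply/eqP; rewrite -normr_eq0.
  by apply: (implyP (v0 j _)); rewrite ?mem_index_enum.
rewrite -(ler_pM2r vpos) mulr_sumr.
have -> : \sum_j `|z| * `|v 0 j| = \sum_j `|(v *m map_mx toC A) 0 j|.
  by apply: eq_bigr => j _; rewrite vA mxE normrM.
apply: (@le_trans _ _ (\sum_j \sum_i `|v 0 i| * toC `|A i j|)).
  apply: ler_sum => j _; rewrite mxE; apply: le_trans (ler_norm_sum _ _ _) _.
  by apply: ler_sum => i _; rewrite normrM mxE normc_real.
rewrite exchange_big mulrC mulr_suml; apply: ler_sum => i _ /=.
rewrite -mulr_sumr ler_wpM2l// -rmorph_sum lecR [leRHS](bigD1 i)//= lerDl.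
by apply: sumr_ge0 => k _; exact: sumr_ge0.
Qed.

Lemma stableP n (A : 'M[R]_n) : stable A <->
  forall a b, 0 <= a -> sqr_charpoly A a b != 0.
Proof.
split=> [stA a b a0|stA z].
  apply/negP => ab0; have := stA (a +i* b)%C.
  by rewrite eigenvalue_sqr_charpoly/= => /(_ ab0); rewrite ltNge a0.
rewrite eigenvalue_sqr_charpoly => /eqP z0; rewrite ltNge; apply/negP => Rez.
by have := stA _ (complex.Im z) Rez; rewrite z0 eqxx.
Qed.

(** Scalar matrices are fixed by conjugation, so the matrix whose determinant is [sqr_charpoly] is
    itself conjugated by [T]. *)
Lemma stable_conj n (A T : 'M[R]_n) : T \in unitmx ->
  stable A -> stable (T *m A *m invmx T).
Proof.
move=> uT /stableP stA; apply/stableP => a b a0.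
suff -> : sqr_charpoly (T *m A *m invmx T) a b = sqr_charpoly A a b.
  exact: stA.
rewrite /sqr_charpoly.
have conj_scalar c : c%:M = T *m c%:M *m invmx T :> 'M[R]_n.
  by rewrite mul_mx_scalar -scalemxAl mulmxV// scalemx1.
have conjD B C :
    T *m B *m invmx T + T *m C *m invmx T = T *m (B + C) *m invmx T.
  by rewrite mulmxDr mulmxDl.
have conjM B C :
    (T *m B *m invmx T) *m (T *m C *m invmx T) = T *m (B *m C) *m invmx T.
  by rewrite !mulmxA mulmxKV.
have conjN B : - (T *m B *m invmx T) = T *m (- B) *m invmx T.
  by rewrite mulmxN mulNmx.
rewrite [in LHS](conj_scalar a) [in LHS](conj_scalar (b * b)) conjN conjD.
rewrite conjM conjD.
by rewrite !det_mulmx det_inv mulrAC mulrV ?mul1r// -unitmxE.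
Qed.

Lemma stable_open n : open [set A : 'M[R]_n | stable A].
Proof.
pose S (A : 'M[R]_n) := \sum_i \sum_j `|A i j|.
have cS : continuous S.
  apply: continuous_big => [|i _]; first exact: add_continuous.
  apply: continuous_big => [|j _]; first exact: add_continuous.
  move=> A; exact: (cvg_norm (@coord_continuous R n n i j A)).
pose E : normedModType R := ('M[R]_n * (R * R))%type.
pose f (x : E) := sqr_charpoly x.1 x.2.1 x.2.2.
have cf : continuous f.
  have sA : smooth_entries setT [set: E] fst.
    move=> i j; apply: smooth_on_linear => [c x y|x]; first by rewrite !mxE.
    apply: (@continuous_comp E _ _ fst (fun M : 'M[R]_n => M i j)).
      exact: fst_continuous.
    exact: coord_continuous.
  have sa : smooth_on setT [set: E] (fun x => x.2.1).
    apply: smooth_on_linear => // x.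
    apply: (@continuous_comp E _ _ snd fst); first exact: snd_continuous.
    exact: fst_continuous.
  have sb : smooth_on setT [set: E] (fun x => x.2.2).
    apply: smooth_on_linear => // x.
    apply: (@continuous_comp E _ _ snd snd); first exact: snd_continuous.
    exact: snd_continuous.
  have sscal (g : E -> R) : smooth_on setT setT g ->
      smooth_entries setT [set: E] (fun x => (g x)%:M : 'M[R]_n).
    move=> sg i j; under eq_fun do rewrite mxE -mulr_natr.
    by apply: smooth_onM => //; exact: smooth_on_cst.
  have sAa : smooth_entries setT [set: E] (fun x => x.1 - (x.2.1)%:M).
    apply: smooth_entriesD => // i j; under eq_fun do rewrite mxE -mulN1r.
    by apply: smooth_onM => //; [exact: smooth_on_cst|exact: sscal].
  apply: smooth_continuous; apply: smooth_on_det => //.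
  apply: smooth_entriesD => //.
    exact: smooth_entries_mulmx.
  by apply: sscal; exact: smooth_onM.
rewrite openE => A /= /stableP stA.
(* The margin 1 keeps [S B < M] for [B] near [A], so a single rectangle [K] catches every unstable
   eigenvalue of all these [B]. *)
pose M := S A + 1.
pose K := `[0, M]%classic `*` `[- M, M]%classic : set (R * R).
have Kcov : near_covering K.
  by apply/compact_near_coveringP; apply: compact_setX; exact: segment_compact.
(* Tube lemma: [f] is nonzero on the compact set of pairs with first component [A], hence on [K]
   simultaneously for all [B] near [A]. *)
have nearK : \forall B \near A, K `<=` fun x => f (B, x) != 0.
  apply: (Kcov _ (nbhs A) (fun B x => f (B, x) != 0)) => -[a b] [/= aM bM].
  have fab : f (A, (a, b)) != 0.
    by apply: stA; move: aM; rewrite in_itv => /andP[].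
  have cfs : continuous (fun x : (R * R) * 'M[R]_n => f (x.2, x.1)).
    move=> x; have sw : (y.2, y.1) @[y --> x] --> (x.2, x.1).
      exact: (cvg_pair (@snd_continuous _ _ x) (@fst_continuous _ _ x)).
    exact: (cvg_comp _ _ sw (cf (x.2, x.1))).
  have nfab : nbhs (f (A, (a, b))) [set y : R | y != 0].
    by apply: open_nbhs_nbhs; split=> //; exact: open_neq.
  exact: (cfs ((a, b), A) _ nfab).
have nearS : \forall B \near A, S B < M.
  have nSA : nbhs (S A) [set y : R | y < M].
    by apply: open_nbhs_nbhs; split; [exact: open_lt|rewrite /= ltrDl].
  exact: (cS A _ nSA).
near=> B; apply/stableP => a b a0; apply/negP => ab0.
have SB : S B < M by near: B; exact: nearS.
have fK : K `<=` fun x => f (B, x) != 0 by near: B; exact: nearK.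
suff Kab : K (a, b) by move: (fK _ Kab); rewrite /f/= ab0.
have := @eigenvalue_bound _ B (a +i* b)%C.
rewrite eigenvalue_sqr_charpoly/= => /(_ ab0).
rewrite normc_def lecR/= => /le_lt_trans => /(_ _ SB) /ltW abM.
have aM : `|a| <= M.
  by apply: le_trans abM; rewrite -sqrtr_sqr ler_wsqrtr// lerDl sqr_ge0.
have bM : `|b| <= M.
  by apply: le_trans abM; rewrite -sqrtr_sqr ler_wsqrtr// lerDr sqr_ge0.
split; rewrite /= in_itv/=; last by rewrite -ler_norml.
by rewrite a0 (le_trans (ler_norm a)).
Unshelve. all: by end_near.
Qed.

End Stability.

(** * Paths of matrices of positive determinant *)

Section PositivePaths.
Variable R : realType.

(** Smoothness on all of [R] lets the entrywise calculus above handle products and blocks; the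
    determinant is controlled on the unit interval only. *)
Definition pos_path n (T : 'M[R]_n) : Prop :=
  exists gamma : R -> 'M[R]_n,
    [/\ smooth_entries setT setT gamma, gamma 0 = 1%:M, gamma 1 = T &
        forall t, 0 <= t <= 1 -> 0 < \det (gamma t)].

Lemma pos_pathM n (S T : 'M[R]_n) :
  pos_path S -> pos_path T -> pos_path (S *m T).
Proof.
move=> [s [ss s0 s1 sp]] [t [st t0 t1 tp]]; exists (fun x => s x *m t x); split.
- exact: smooth_entries_mulmx.
- by rewrite s0 t0 mulmx1.
- by rewrite s1 t1.
- by move=> x x01; rewrite det_mulmx mulr_gt0 ?sp ?tp.
Qed.

Let smooth_scale a b (M : 'M[R]_(a, b)) :
  smooth_entries setT [set: R] (fun t => t *: M).
Proof.
apply: smooth_entriesZ => //; first exact: smooth_on_id.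
exact: smooth_entries_cst.
Qed.

Lemma pos_path_lower n (c : 'M[R]_(n, 1)) :
  pos_path (block_mx 1%:M 0 c 1%:M : 'M[R]_(1 + n)).
Proof.
exists (fun t => block_mx 1%:M 0 (t *: c) 1%:M); split.
- apply: smooth_entries_block => //; exact: smooth_entries_cst.
- by rewrite scale0r -scalar_mx_block.
- by rewrite scale1r.
- by move=> t _; rewrite det_lblock !det1 mulr1.
Qed.

Lemma pos_path_upper n (r : 'M[R]_(1, n)) :
  pos_path (block_mx 1%:M r 0 1%:M : 'M[R]_(1 + n)).
Proof.
exists (fun t => block_mx 1%:M (t *: r) 0 1%:M); split.
- apply: smooth_entries_block => //; exact: smooth_entries_cst.
- by rewrite scale0r -scalar_mx_block.
- by rewrite scale1r.
- by move=> t _; rewrite det_ublock !det1 mulr1.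
Qed.

Lemma pos_path_block n (T : 'M[R]_n) :
  pos_path T -> pos_path (block_mx 1%:M 0 0 T : 'M[R]_(1 + n)).
Proof.
move=> [s [ss s0 s1 sp]]; exists (fun x => block_mx 1%:M 0 0 (s x)); split.
- apply: smooth_entries_block => //; exact: smooth_entries_cst.
- by rewrite s0 -scalar_mx_block.
- by rewrite s1.
- by move=> t t01; rewrite det_ublock !det1 mul1r sp.
Qed.

Lemma ex_row_dual n (c : 'cV[R]_n) (x : 'M[R]_1) : c != 0 ->
  exists r : 'rV[R]_n, r *m c = x.
Proof.
move=> /cV0Pn[i ci]; exists ((x 0 0 / c i 0) *: delta_mx 0 i).
rewrite -scalemxAl -rowE; apply/matrixP => j k.
by rewrite !ord1 !mxE divfK.
Qed.

(** Gaussian elimination by induction on the size: each row operation is a unitriangular factor,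
    joined to the identity by scaling its off-diagonal block. *)
Lemma pos_pathP n (T : 'M[R]_n) : 0 < \det T -> pos_path T.
Proof.
elim: n T => [|n IH] T T0.
  exists (fun=> T); split=> //; first exact: smooth_entries_cst.
  by rewrite [T]flatmx0 [RHS]flatmx0.
change 'M[R]_(1 + n) in T.
(* With corner 1, [M] is lower times block diagonal times upper, where [D] is the Schur complement
   and has the determinant of [M]. *)
have unit_corner (M : 'M[R]_(1 + n)) :
    0 < \det M -> ulsubmx M = 1%:M -> pos_path M.
  move=> M0 M1; pose D := drsubmx M - dlsubmx M *m ursubmx M.
  have ME : M = block_mx 1%:M 0 (dlsubmx M) 1%:M *m block_mx 1%:M 0 0 D *m
      block_mx 1%:M (ursubmx M) 0 1%:M.
    rewrite !mulmx_block !(mulmx0, mul0mx, mulmx1, mul1mx, addr0, add0r).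
    by rewrite /D addrC subrK -[LHS]submxK M1.
  rewrite ME; apply: pos_pathM (pos_path_upper _).
  apply: pos_pathM (pos_path_lower _) _; apply: pos_path_block; apply: IH.
  by move: M0; rewrite ME !det_mulmx det_lblock !det_ublock !det1 !mul1r !mulr1.
(* A suitable combination [r] of the lower rows, added to the first row, turns the corner into 1. *)
have nonzero_column (M : 'M[R]_(1 + n)) :
    0 < \det M -> dlsubmx M != 0 -> pos_path M.
  move=> M0 /(ex_row_dual (1%:M - ulsubmx M))[r rM].
  pose U := block_mx 1%:M r 0 1%:M : 'M[R]_(1 + n).
  have -> : M = block_mx 1%:M (- r) 0 1%:M *m (U *m M).
    rewrite mulmxA /U mulmx_block.
    rewrite !(mulmx0, mul0mx, mulmx1, mul1mx, addr0, add0r).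
    by rewrite subrr -scalar_mx_block mul1mx.
  apply: pos_pathM (pos_path_upper _) _; apply: unit_corner.
    by rewrite det_mulmx det_ublock !det1 !mul1r.
  by rewrite -[M]submxK mulmx_block block_mxKul mul1mx rM addrC subrK.
have [c0|] := eqVneq (dlsubmx T) 0; last exact: nonzero_column.
have detT : \det T = \det (ulsubmx T) * \det (drsubmx T).
  by rewrite -[in LHS](submxK T) c0 det_ublock.
(* For size 1, the segment from 1 to the positive entry of [T] stays positive. *)
case: n => [|n] in T T0 c0 detT IH unit_corner nonzero_column *.
  exists (fun t => (1 + -1 * t) *: 1%:M + t *: T); split.
  - apply: smooth_entriesD => //; apply: smooth_entriesZ => //.
      apply: smooth_onD => //; first exact: smooth_on_cst.
      by apply: smooth_onM => //; [exact: smooth_on_cst|exact: smooth_on_id].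
    exact: smooth_entries_cst.
  - by rewrite mulr0 addr0 scale1r scale0r addr0.
  - by rewrite mulr1 subrr scale0r scale1r add0r.
  - move=> t /andP[t0 t1]; move: T0.
    rewrite !(@det_mx11 R) !mxE mulr1 mulN1r => T0.
    have [->|tn0] := eqVneq t 0; first by rewrite subr0 mul0r addr0.
    by rewrite ltr_wpDl ?subr_ge0// mulr_gt0// lt_def tn0.
(* The column below the corner vanishes, so the corner is nonzero; adding the first row to all
   others brings back the previous case. *)
pose c : 'M[R]_(n.+1, 1) := const_mx 1.
have -> : T = block_mx 1%:M 0 (- c) 1%:M *m (block_mx 1%:M 0 c 1%:M *m T).
  rewrite mulmxA mulmx_block !(mulmx0, mul0mx, mulmx1, mul1mx, addr0, add0r).
  by rewrite addNr -scalar_mx_block mul1mx.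
apply: pos_pathM (pos_path_lower _) _; apply: nonzero_column.
  by rewrite det_mulmx det_lblock !det1 !mul1r.
rewrite -[T]submxK mulmx_block block_mxKdl c0 mulmx0 addr0.
apply/negP => /eqP/matrixP/(_ 0 0); rewrite !mxE big_ord1 !mxE mul1r => T00.
by move: T0; rewrite detT det_mx11 !mxE T00 mul0r ltxx.
Qed.

End PositivePaths.

(** * Nice selections *)

Section NiceSelection.
Variables (F : fieldType) (p q : nat).
Implicit Types (B : 'M[F]_(q, p)) (A E : 'M[F]_q) (g : 'I_q -> 'I_(p + q)).

Definition selected_columns g B A E : 'M[F]_q := colsub g (row_mx B (A *m E)).

(* The iteration reaches a fixed point of [selected_columns] as soon as each
   selected column of [row_mx B (A *m E)] only involves earlier columns of [E],
   which is what [nice] requires. *)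
Definition selected_basis g B A : 'M[F]_q :=
  iter q (selected_columns g B A) 0.

(** Index [p + j] stands for [A] times column [j] and smaller indices for columns of [B], so the
    bound says [j < k]. *)
Definition nice g := forall k : 'I_q, (g k < p + k)%N.

Lemma selected_columns_agree g B A E E' n : nice g ->
  (forall i j : 'I_q, (j < n)%N -> E i j = E' i j) ->
  forall i j : 'I_q, (j < n.+1)%N ->
    selected_columns g B A E i j = selected_columns g B A E' i j.
Proof.
move=> gn EE' i j jn; rewrite [LHS]mxE [RHS]mxE.
case: (split_ordP (g j)) => k gk; rewrite gk ?row_mxEl// !row_mxEr.
have kj : (k < n)%N.
  by have := gn j; rewrite gk ltn_add2l => /leq_trans; apply.
by rewrite !mxE; apply: eq_bigr => l _; rewrite EE'.
Qed.

Lemma selected_basis_uniq g B A E E' : nice g ->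
  E = selected_columns g B A E -> E' = selected_columns g B A E' -> E = E'.
Proof.
move=> gn EE EE'; apply/matrixP => i j.
suff agree n : forall i j : 'I_q, (j < n)%N -> E i j = E' i j.
  exact: (agree q).
elim: n => // n IH {}i {}j; rewrite EE EE'; exact: selected_columns_agree.
Qed.

(** After [n] iterations the first [n] columns are final, so [q] iterations reach the fixed
    point. *)
Lemma selected_basisP g B A : nice g ->
  selected_basis g B A = selected_columns g B A (selected_basis g B A).
Proof.
move=> gn; rewrite -[RHS]iterS; apply/matrixP => i j.
suff agree n : forall i j : 'I_q, (j < n)%N ->
    iter n (selected_columns g B A) 0 i j =
    iter n.+1 (selected_columns g B A) 0 i j by exact: (agree q).
elim: n => // n IH {}i {}j jn.
rewrite [in LHS]iterS [in RHS]iterS; exact: (selected_columns_agree _ _ gn IH).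
Qed.

Lemma selected_basis_eq g B A E : nice g ->
  E = selected_columns g B A E -> selected_basis g B A = E.
Proof.
by move=> gn; apply: selected_basis_uniq => //; exact: selected_basisP.
Qed.

(** [T *m E] solves the fixed point equation of the transformed pair, and the solution is unique. *)
Lemma selected_basis_conj g B A T : nice g -> T \in unitmx ->
  selected_basis g (T *m B) (T *m A *m invmx T) = T *m selected_basis g B A.
Proof.
move=> gn uT; apply: selected_basis_eq => //.
rewrite [in LHS]selected_basisP// /selected_columns !mulmxA mulmxKV//.
by rewrite -mulmxA -mul_mx_row mulmx_colsub.
Qed.

Lemma selected_basis_eq1 g B A : nice g ->
  (selected_basis g B A == 1%:M) = (colsub g (row_mx B A) == 1%:M).
Proof.
move=> gn; apply/eqP/eqP => [E1|X1].
  by have := selected_basisP B A gn; rewrite E1 /selected_columns mulmx1.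
by apply: selected_basis_eq; rewrite // /selected_columns mulmx1.
Qed.

(** A repeated index would give two equal columns in an invertible matrix. *)
Lemma nice_selection_inj g B A :
  nice g -> selected_basis g B A \in unitmx -> injective g.
Proof.
move=> gn uE j k gjk; have [//|jk] := eqVneq j k.
set E := selected_basis g B A in uE.
have colE : E *m delta_mx j 0 = E *m delta_mx k 0 :> 'cV_q.
  apply/colP => i; rewrite -!colE !mxE.
  by rewrite /E selected_basisP// !mxE gjk.
have := congr1 (mulmx (invmx E)) colE; rewrite !mulKmx// => /colP/(_ j).
by rewrite !mxE !eqxx (negPf jk) /= => /eqP; rewrite oner_eq0.
Qed.

(* Greedy choice: as long as the columns chosen so far span a proper subspace,
   controllability prevents it from containing [B] and being [A]-invariant, so
   some column of [B] or [A]-image of a chosen column leaves the span. *)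
Lemma exists_nice_selection B A :
  row_free (\mxrow_(i < q) (A ^+ i *m B)) ->
  exists2 g, nice g & selected_basis g B A \in unitmx.
Proof.
move=> ctrl.
(* [next e l] is column [l] of the infinite row [B, A e_0, A e_1, ...]. *)
pose next (e : nat -> 'cV[F]_q) l : 'cV[F]_q :=
  if insub l is Some j then col (j : 'I_p) B else A *m e (l - p)%N.
pose mktup (e : nat -> 'cV[F]_q) k : k.-tuple 'cV[F]_q :=
  Tuple (introT eqP (size_mkseq e k)).
have greedy k : (k <= q)%N -> exists (e : nat -> 'cV[F]_q) (sel : nat -> nat), 
    (forall i, (i < k)%N -> (sel i < p + i)%N /\ e i = next e (sel i)) /\
    free (mkseq e k).
  elim: k => [_|k IH kq].
    by exists (fun=> 0), (fun=> 0%N); split=> //; rewrite nil_free.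
  have [e [sel [eg fe]]] := IH (ltnW kq); pose W := <<mkseq e k>>%VS.
  have [l lk lW] : exists2 l, (l < p + k)%N & next e l \notin W.
    apply: contrapT => noext.
    have inW l : (l < p + k)%N -> next e l \in W.
      by move=> lk; apply: contrapT => /negP lW; apply: noext; exists l.
    have BW j : col j B \in W.
      have := inW (val j); rewrite /next valK; apply.
      exact: (ltn_addr k (ltn_ord j)).
    have AW w : w \in W -> A *m w \in W.
      move=> /(@coord_span _ _ _ (mktup e k)) ->.
      rewrite mulmx_sumr memv_suml// => i _; rewrite -scalemxAr memvZ//=.
      have := inW (p + i)%N; rewrite ltn_add2l ltn_ord => /(_ isT).
      by rewrite /next insubF ?ltnNge ?leq_addr// addKn nth_mkseq.
    have AnBW n (y : 'cV_p) : A ^+ n *m (B *m y) \in W.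
      elim: n => [|n IHn]; last by rewrite exprS -mulmxA AW.
      rewrite expr0 mul1mx (_ : B *m y = \sum_j y j 0 *: col j B).
        by apply: memv_suml => j _; rewrite memvZ.
      apply/colP => i; rewrite mxE summxE; apply: eq_bigr => j _.
      by rewrite !mxE mulrC.
    (* A right inverse [D] of the Kalman matrix writes any vector as a sum of terms [A^i B y], all
       of which lie in [W]. *)
    have fullW : (fullv <= W)%VS.
      apply/subvP => w _; have /row_freeP[D KD] := ctrl.
      rewrite -[w]mul1mx -KD -mulmxA -[D *m w]submxcolK mul_mxrow_mxcol.
      by apply: memv_suml => i _; rewrite -mulmxA.
    (* [W] is spanned by [k < q] vectors, so it cannot be the whole space. *)
    have := dimvS fullW; rewrite dimvf /dim /= muln1 leqNgt.
    by rewrite (leq_ltn_trans (dim_span _))// size_mkseq.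
  pose upd T (f : nat -> T) y i := if i == k then y else f i.
  exists (upd _ e (next e l)), (upd _ sel l).
  have old i : (i < k)%N -> upd _ e (next e l) i = e i.
      by move=> ik; rewrite /upd ltn_eqF.
    (* Such an index refers only to vectors before position [k], which the update leaves alone. *)
    have old_next i l' : (i <= k)%N -> (l' < p + i)%N ->
        next (upd _ e (next e l)) l' = next e l'.
      move=> ik li; rewrite /next; case: insubP => //; rewrite -leqNgt => pl.
      by rewrite old// -(ltn_add2l p) subnKC// (leq_trans li)// leq_add2l.
  split.
    move=> i; rewrite ltnS leq_eqVlt => /orP[/eqP->|ik].
      by rewrite {1 2 4}/upd eqxx (old_next k).
    have [gi ei] := eg i ik; rewrite old// {1 3}/upd ltn_eqF// (old_next i)//.
    exact: ltnW.
  have -> : mkseq (upd _ e (next e l)) k.+1 = rcons (mkseq e k) (next e l).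
    rewrite mkseqS {2}/upd eqxx; congr rcons.
    by apply/eq_in_map => i; rewrite mem_iota add0n => /andP[_ ik]; exact: old.
  by rewrite (perm_free (permEl (perm_rcons _ _))) free_cons lW.
have [e [sel [eg fe]]] := greedy q (leqnn q).
have gq (k : 'I_q) : (sel k < p + q)%N.
  by have [gk _] := eg k (ltn_ord k); rewrite (leq_trans gk)// leq_add2l ltnW.
exists (fun k => Ordinal (gq k)).
  by move=> k; have [] := eg k (ltn_ord k).
pose E := \matrix_(i, j < q) e j i 0.
rewrite (@selected_basis_eq _ _ _ E).
- suff [D ED] : exists D, E *m D = 1%:M by have [] := mulmx1_unit ED.
  pose X := mktup e q.
  have spanX (v : 'cV_q) : v \in <<X>>%VS.
    apply: (subvP _ _ (memvf v)).
    rewrite -(geq_leqif (dimv_leqif_sup (subvf _))).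
    by rewrite dimvf /dim /= muln1 (eqP fe) size_mkseq.
  (* The right inverse has as columns the coordinates of the standard basis vectors in the chosen
     family. *)
  exists (\matrix_(i, j < q) coord X i (delta_mx j 0)).
  apply/matrixP => i j; have /colP/(_ i) := coord_span (spanX (delta_mx j 0)).
  rewrite !mxE eqxx andbT => ->; rewrite summxE; apply: eq_bigr => k _.
  by rewrite !mxE nth_mkseq// mulrC.
- by move=> k; have [] := eg k (ltn_ord k).
- apply/matrixP => i j; have [gj ej] := eg j (ltn_ord j).
  rewrite [in RHS]mxE /=.
  case: (split_ordP (Ordinal (gq j))) => k gk.
    rewrite gk row_mxEl mxE ej /next.
    by have /= -> := congr1 val gk; rewrite valK mxE.
  rewrite gk row_mxEr !mxE ej /next.
  have /= -> := congr1 val gk; rewrite insubF ?ltnNge ?leq_addr// addKn mxE.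
  by apply: eq_bigr => l _; rewrite mxE.
Qed.

End NiceSelection.

(** * The chart *)

Section SimilarityAction.
Variables (R : realType) (m p q : nat).
Implicit Types (K : 'M[R]_(m + q, p + q)) (S T : 'M[R]_q).

Lemma invmxM n (S T : 'M[R]_n) : S \in unitmx -> T \in unitmx ->
  invmx (S *m T) = invmx T *m invmx S.
Proof.
move=> uS uT; have uST : S *m T \in unitmx by rewrite unitmx_mul uS.
by rewrite -[RHS](mulmxK uST) mulmxA mulmxKV// mulVmx// mul1mx.
Qed.

Lemma ctrlA_similarity T K :
  ctrlA (similarity T K) = T *m ctrlA K *m invmx T.
Proof. exact: block_mxKdr. Qed.

Lemma ctrlB_similarity T K : ctrlB (similarity T K) = T *m ctrlB K.
Proof. exact: block_mxKdl. Qed.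

Lemma ctrlC_similarity T K : ctrlC (similarity T K) = ctrlC K *m invmx T.
Proof. exact: block_mxKur. Qed.

Lemma controllers_similarity T K : controllers (similarity T K).
Proof. exact: block_mxKul. Qed.

Lemma similarityM S T K : S \in unitmx -> T \in unitmx ->
  similarity S (similarity T K) = similarity (S *m T) K.
Proof.
move=> uS uT; rewrite [LHS]/similarity ctrlA_similarity ctrlB_similarity.
by rewrite ctrlC_similarity /similarity invmxM// !mulmxA.
Qed.

Lemma similarity1 K : controllers K -> similarity 1%:M K = K.
Proof.
move=> K0; rewrite /similarity invmx1 !mulmx1 !mul1mx -[RHS]submxK.
by rewrite [ulsubmx K]K0.
Qed.

Lemma similarityKV T K : T \in unitmx -> controllers K ->
  similarity T (similarity (invmx T) K) = K.
Proof.
by move=> uT K0; rewrite similarityM ?unitmx_inv// mulmxV// similarity1.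
Qed.

Lemma stabilizing_similarity n (A : 'M[R]_n) (B : 'M[R]_(n, m))
    (C : 'M[R]_(p, n)) T K : T \in unitmx ->
  stabilizing A B C K -> stabilizing A B C (similarity T K).
Proof.
move=> uT [_ stK]; split; first exact: controllers_similarity.
pose P : 'M[R]_(n + q) := block_mx 1%:M 0 0 T.
have uP : P \in unitmx by rewrite block_diag_mx_unit unitmx1.
suff -> : closed_loop A B C (similarity T K) =
    P *m closed_loop A B C K *m invmx P by exact: stable_conj.
rewrite invmx_block_diag// invmx1 /closed_loop.
rewrite ctrlA_similarity ctrlB_similarity ctrlC_similarity.
rewrite !mulmx_block.
by rewrite !(mulmx0, mul0mx, mulmx1, mul1mx, addr0, add0r) !mulmxA.
Qed.

End SimilarityAction.

(** The complement of the image has [p] elements, which fill the first [p] places. The permutation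
    moves the selected columns of [[B_K A_K]] to the right. *)
Lemma extend_to_perm p q (g : 'I_q -> 'I_(p + q)) : injective g ->
  exists s : 'S_(p + q), forall k, s (rshift p k) = g k.
Proof.
move=> gI; pose D := ~: [set g k | k : 'I_q].
have cD : #|D| = p.
  by rewrite cardsCs finset.setCK card_imset// !card_ord addnK.
pose f (i : 'I_(p + q)) : 'I_(p + q) := match fintype.split i with
  | inl j => enum_val (cast_ord (esym cD) j)
  | inr k => g k
  end.
have fI : injective f.
  have gD k j : g k != enum_val (cast_ord (esym cD) j).
    apply: contraTneq (enum_valP (cast_ord (esym cD) j)) => <-.
    by rewrite inE negbK imset_f.
  move=> i j; rewrite /f.
  case: (fintype.splitP i) => i' ii'; case: (fintype.splitP j) => j' jj'.
  - move=> /enum_val_inj/cast_ord_inj ij.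
    by apply: val_inj; rewrite /= ii' ij jj'.
  - by move=> /esym/eqP; rewrite (negPf (gD _ _)).
  - by move=> /eqP; rewrite (negPf (gD _ _)).
  - by move=> /gI ij; apply: val_inj; rewrite /= ii' ij jj'.
by exists (perm fI) => k; rewrite permE /f; case: fintype.splitP => [j|j] /=;
  [move=> jk; have := ltn_ord j; rewrite -jk ltnNge leq_addr
  |move=> /addnI/val_inj ->].
Qed.

Section Chart.
Variables (R : realType) (m p q : nat).
Variables (g : 'I_q -> 'I_(p + q)) (s : 'S_(p + q)).
Hypotheses (g_nice : nice g) (sg : forall k, s (rshift p k) = g k).
Local Notation E := 'M[R]_(m + q, p + q).
Local Notation dimc := (m * q + q * p)%N.
Implicit Types (K : E) (T : 'M[R]_q).

Definition ctrl_basis K : 'M[R]_q := selected_basis g (ctrlB K) (ctrlA K).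

Lemma ctrl_basis_similarity T K : T \in unitmx ->
  ctrl_basis (similarity T K) = T *m ctrl_basis K.
Proof.
move=> uT.
by rewrite /ctrl_basis ctrlB_similarity ctrlA_similarity selected_basis_conj.
Qed.

(** When [ctrl_basis K] is invertible, this is the only point of the orbit of [K] at which
    [ctrl_basis] is the identity. *)
Definition normalize K : E := similarity (invmx (ctrl_basis K)) K.

Lemma normalize_similarity T K : T \in unitmx -> ctrl_basis K \in unitmx ->
  normalize (similarity T K) = normalize K.
Proof.
move=> uT uK; rewrite /normalize ctrl_basis_similarity// similarityM//.
  by rewrite invmxM// mulmxKV.
by rewrite unitmx_inv unitmx_mul uT.
Qed.

Lemma ctrl_basis_normalize K : ctrl_basis K \in unitmx ->
  ctrl_basis (normalize K) = 1%:M.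
Proof.
by move=> uK; rewrite ctrl_basis_similarity ?unitmx_inv// mulVmx.
Qed.

(* The entries of [K] left free by the equation [ctrl_basis K = 1%:M]. *)
Definition coords K : 'rV[R]_dimc :=
  row_mx (mxvec (ctrlC K)) (mxvec (lsubmx (col_perm s (dsubmx K)))).

(** Affine parametrization of the controllers with [ctrl_basis K = 1%:M]: the identity is put back
    into the selected columns, and [w] fills the remaining free entries. *)
Definition slice (w : 'rV[R]_dimc) : E :=
  col_mx (row_mx 0 (vec_mx (lsubmx w)))
         (col_perm s^-1%g (row_mx (vec_mx (rsubmx w)) 1%:M)).

Lemma controllers_slice w : controllers (slice w).
Proof. by rewrite /controllers/= /ulsubmx col_mxKu row_mxKl. Qed.

Lemma sliceK w : coords (slice w) = w.
Proof.
rewrite /coords /ctrlC /ursubmx /slice col_mxKu col_mxKd row_mxKr vec_mxK.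
by rewrite -col_permM mulgV col_perm1 row_mxKl vec_mxK hsubmxK.
Qed.

Lemma ctrl_basis1 K :
  (ctrl_basis K == 1%:M) = (rsubmx (col_perm s (dsubmx K)) == 1%:M).
Proof.
rewrite /ctrl_basis selected_basis_eq1//; congr (_ == _).
rewrite /ctrlB /ctrlA /dlsubmx /drsubmx hsubmxK; apply/matrixP => i j.
by rewrite !mxE sg.
Qed.

Lemma ctrl_basis_slice w : ctrl_basis (slice w) = 1%:M.
Proof.
apply/eqP; rewrite ctrl_basis1 /slice col_mxKd.
by rewrite -col_permM mulgV col_perm1 row_mxKr.
Qed.

Lemma coordsK K : controllers K -> ctrl_basis K = 1%:M -> slice (coords K) = K.
Proof.
move=> K0 /eqP; rewrite ctrl_basis1 => /eqP K1.
rewrite /slice /coords row_mxKl row_mxKr !mxvecK -K1 hsubmxK.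
rewrite -col_permM mulVg col_perm1 -[RHS]vsubmxK; congr col_mx.
by rewrite -[RHS]hsubmxK; congr row_mx; rewrite -[LHS]K0.
Qed.

Lemma coords_normalizeK K : ctrl_basis K \in unitmx ->
  slice (coords (normalize K)) = normalize K.
Proof.
move=> uK; apply: coordsK; first exact: controllers_similarity.
exact: ctrl_basis_normalize.
Qed.

Variable K0 : E.
Hypothesis K0_basis : ctrl_basis K0 \in unitmx.

(** The first block locates [K] within its orbit and the second tells which orbit it is; the shift
    sends the orbit of [K0] to zero. The dimension [(q ^ 2)%N] is convertible to [q * q]. *)
Definition chart K : 'rV[R]_((q ^ 2)%N + dimc) :=
  row_mx (mxvec (ctrl_basis K)) (coords (normalize K) - coords (normalize K0)).

Definition chart_inv (v : 'rV[R]_((q ^ 2)%N + dimc)) : E :=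
  similarity (vec_mx (lsubmx v : 'rV_(q * q)))
    (slice (coords (normalize K0) + rsubmx v)).

Lemma chartK K : controllers K -> ctrl_basis K \in unitmx ->
  chart_inv (chart K) = K.
Proof.
move=> Kc uK; rewrite /chart_inv /chart row_mxKl row_mxKr mxvecK addrC subrK.
rewrite coords_normalizeK//.
exact: similarityKV.
Qed.

Lemma chart_invK v : vec_mx (lsubmx v : 'rV_(q * q)) \in @unitmx R q ->
  chart (chart_inv v) = v.
Proof.
move=> uv; have uE w : ctrl_basis (slice w) \in unitmx.
  by rewrite ctrl_basis_slice unitmx1.
rewrite /chart normalize_similarity// ctrl_basis_similarity//.
rewrite ctrl_basis_slice mulmx1 vec_mxK /normalize ctrl_basis_slice invmx1.
rewrite similarity1 ?sliceK; last exact: controllers_slice.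
by rewrite addrC addKr hsubmxK.
Qed.

(** Equal coordinates mean equal normal forms, and then [ctrl_basis K *m invmx (ctrl_basis K0)]
    carries [K0] to [K]. *)
Lemma chart_orbit K : controllers K -> ctrl_basis K \in unitmx ->
  rsubmx (chart K) = 0 <-> orbit_of K0 K.
Proof.
move=> Kc uK; rewrite /chart row_mxKr; split.
  move=> /subr0_eq nKK0.
  have nE : normalize K = normalize K0.
    rewrite -(coords_normalizeK uK) nKK0; exact: coords_normalizeK.
  exists (ctrl_basis K *m invmx (ctrl_basis K0)).
    by rewrite /= unitmx_mul uK unitmx_inv.
  have uK0 : invmx (ctrl_basis K0) \in unitmx by rewrite unitmx_inv.
  rewrite -(similarityM K0 uK uK0); have := similarityKV uK Kc.
  by rewrite -/(normalize K) nE.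
by move=> [T uT <-]; rewrite normalize_similarity// subrr.
Qed.

End Chart.

(** * Smoothness of the chart and of its inverse *)

Section SmoothSystems.
Variables (R : realType) (D : normedModType R) (V U : set D).
Hypothesis V_lin : forall (h : R) (v x : D), V v -> V x -> V (h *: v + x).
Hypothesis U_open : relatively_open V U.
Local Notation smooth := (smooth_entries V U).

Lemma smooth_entries_lsubmx a b1 b2 (M : D -> 'M[R]_(a, b1 + b2)) :
  smooth M -> smooth (fun x => lsubmx (M x)).
Proof. by move=> sM i j; under eq_fun do rewrite mxE; exact: sM. Qed.

Lemma smooth_entries_rsubmx a b1 b2 (M : D -> 'M[R]_(a, b1 + b2)) :
  smooth M -> smooth (fun x => rsubmx (M x)).
Proof. by move=> sM i j; under eq_fun do rewrite mxE; exact: sM. Qed.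

Lemma smooth_entries_usubmx a1 a2 b (M : D -> 'M[R]_(a1 + a2, b)) :
  smooth M -> smooth (fun x => usubmx (M x)).
Proof. by move=> sM i j; under eq_fun do rewrite mxE; exact: sM. Qed.

Lemma smooth_entries_dsubmx a1 a2 b (M : D -> 'M[R]_(a1 + a2, b)) :
  smooth M -> smooth (fun x => dsubmx (M x)).
Proof. by move=> sM i j; under eq_fun do rewrite mxE; exact: sM. Qed.

Lemma smooth_entries_colsub a b b' (f : 'I_b' -> 'I_b) (M : D -> 'M[R]_(a, b)) :
  smooth M -> smooth (fun x => colsub f (M x)).
Proof. by move=> sM i j; under eq_fun do rewrite mxE; exact: sM. Qed.

Lemma smooth_entries_vec_mx a b (M : D -> 'rV[R]_(a * b)) :
  smooth M -> smooth (fun x => vec_mx (M x)).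
Proof. by move=> sM i j; under eq_fun do rewrite mxE; exact: sM. Qed.

Lemma smooth_entries_mxvec a b (M : D -> 'M[R]_(a, b)) :
  smooth M -> smooth (fun x => mxvec (M x)).
Proof.
move=> sM i k; rewrite ord1; case/mxvec_indexP: k => j l.
by under eq_fun do rewrite mxvecE; exact: sM.
Qed.

Lemma smooth_entries_row_mx a b1 b2 (M : D -> 'M[R]_(a, b1))
    (N : D -> 'M[R]_(a, b2)) :
  smooth M -> smooth N -> smooth (fun x => row_mx (M x) (N x)).
Proof.
move=> sM sN i j; case: (split_ordP j) => k ->.
  by under eq_fun do rewrite row_mxEl; exact: sM.
by under eq_fun do rewrite row_mxEr; exact: sN.
Qed.

Lemma smooth_entries_col_mx a1 a2 b (M : D -> 'M[R]_(a1, b))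
    (N : D -> 'M[R]_(a2, b)) :
  smooth M -> smooth N -> smooth (fun x => col_mx (M x) (N x)).
Proof.
move=> sM sN i j; case: (split_ordP i) => k ->.
  by under eq_fun do rewrite col_mxEu; exact: sM.
by under eq_fun do rewrite col_mxEd; exact: sN.
Qed.

Variables (m p q : nat).
Implicit Type K : D -> 'M[R]_(m + q, p + q).

Lemma smooth_ctrlA K : smooth K -> smooth (fun x => ctrlA (K x)).
Proof.
by move=> sK; apply: smooth_entries_rsubmx; exact: smooth_entries_dsubmx.
Qed.

Lemma smooth_ctrlB K : smooth K -> smooth (fun x => ctrlB (K x)).
Proof.
by move=> sK; apply: smooth_entries_lsubmx; exact: smooth_entries_dsubmx.
Qed.

Lemma smooth_ctrlC K : smooth K -> smooth (fun x => ctrlC (K x)).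
Proof.
by move=> sK; apply: smooth_entries_rsubmx; exact: smooth_entries_usubmx.
Qed.

Lemma smooth_closed_loop n (A : 'M[R]_n) (B : 'M[R]_(n, m))
    (C : 'M[R]_(p, n)) K :
  smooth K -> smooth (fun x => closed_loop A B C (K x)).
Proof.
move=> sK; apply: smooth_entries_block; first exact: smooth_entries_cst.
- apply: smooth_entries_mulmx => //; first exact: smooth_entries_cst.
  exact: smooth_ctrlC.
- apply: smooth_entries_mulmx => //; first exact: smooth_ctrlB.
  exact: smooth_entries_cst.
- exact: smooth_ctrlA.
Qed.

Lemma smooth_similarity (T : D -> 'M[R]_q) K :
  (forall x, U x -> T x \in unitmx) -> smooth T -> smooth K ->
  smooth (fun x => similarity (T x) (K x)).
Proof.
move=> uT sT sK; have sTV : smooth (fun x => invmx (T x)).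
  exact: smooth_entries_invmx.
have sA := smooth_ctrlA sK; have sB := smooth_ctrlB sK.
have sC := smooth_ctrlC sK.
apply: smooth_entries_block; first exact: smooth_entries_cst.
- exact: smooth_entries_mulmx.
- exact: smooth_entries_mulmx.
- by apply: smooth_entries_mulmx => //; exact: smooth_entries_mulmx.
Qed.

Lemma smooth_ctrl_basis (g : 'I_q -> 'I_(p + q)) K :
  smooth K -> smooth (fun x => ctrl_basis g (K x)).
Proof.
move=> sK; rewrite /ctrl_basis /selected_basis.
suff sn n : smooth (fun x =>
    iter n (selected_columns g (ctrlB (K x)) (ctrlA (K x))) 0) by exact: (sn q).
elim: n => [|n IH] /=; first exact: smooth_entries_cst.
apply: smooth_entries_colsub; apply: smooth_entries_row_mx.
  exact: smooth_ctrlB.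
by apply: smooth_entries_mulmx => //; exact: smooth_ctrlA.
Qed.

Lemma smooth_normalize (g : 'I_q -> 'I_(p + q)) K :
  (forall x, U x -> ctrl_basis g (K x) \in unitmx) ->
  smooth K -> smooth (fun x => normalize g (K x)).
Proof.
move=> uK sK; have sE : smooth (fun x => ctrl_basis g (K x)).
  exact: smooth_ctrl_basis.
apply: smooth_similarity => //; last exact: smooth_entries_invmx.
by move=> x Ux; rewrite unitmx_inv uK.
Qed.

Lemma smooth_coords (s : 'S_(p + q)) K :
  smooth K -> smooth (fun x => coords s (K x)).
Proof.
move=> sK; apply: smooth_entries_row_mx; apply: smooth_entries_mxvec.
  exact: smooth_ctrlC.
apply: smooth_entries_lsubmx => i j; under eq_fun do rewrite mxE.
exact: smooth_entries_dsubmx.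
Qed.

Lemma smooth_slice (s : 'S_(p + q)) (w : D -> 'rV[R]_(m * q + q * p)) :
  smooth w -> smooth (fun x => slice s (w x)).
Proof.
move=> sw; apply: smooth_entries_col_mx.
  apply: smooth_entries_row_mx; first exact: smooth_entries_cst.
  by apply: smooth_entries_vec_mx; exact: smooth_entries_lsubmx.
move=> i j; under eq_fun do rewrite mxE; move: i (s^-1%g j) => {}i {}j.
apply: smooth_entries_row_mx; last exact: smooth_entries_cst.
by apply: smooth_entries_vec_mx; exact: smooth_entries_rsubmx.
Qed.

End SmoothSystems.

Lemma controllers_lin (R : realType) m p q (h : R)
    (v x : 'M[R]_(m + q, p + q)) :
  controllers v -> controllers x -> controllers (h *: v + x).
Proof.
rewrite /controllers/= => v0 x0.
have -> : ulsubmx (h *: v + x) = h *: ulsubmx v + ulsubmx x.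
  by apply/matrixP => i j; rewrite !mxE.
by rewrite v0 x0 scaler0 addr0.
Qed.

Lemma continuous_open_preimage (T S : topologicalType) (f : T -> S)
    (B : set S) :
  continuous f -> open B -> open (f @^-1` B).
Proof. by move=> cf oB; apply: open_comp => // x _; exact: cf. Qed.

Lemma open_unitmx (R : realType) (D : normedModType R) n (M : D -> 'M[R]_n) :
  smooth_entries setT setT M -> open [set x | M x \in unitmx].
Proof.
move=> sM; have -> : [set x | M x \in unitmx] =
    (fun x => \det (M x)) @^-1` [set y : R | y != 0].
  by apply/seteqP; split=> x /=; rewrite unitmxE unitfE.
apply: continuous_open_preimage; last exact: open_neq.
apply: smooth_continuous; exact: smooth_on_det.
Qed.

Lemma open_stable (R : realType) (D : normedModType R) n (M : D -> 'M[R]_n) :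
  smooth_entries setT setT M -> open [set x | stable (M x)].
Proof.
move=> sM; apply: (continuous_open_preimage (f := M)); last exact: stable_open.
apply: smooth_continuous; exact: smooth_on_mx.
Qed.

(** * The orbit as a slice of the chart *)

Section OrbitManifold.
Variables (R : realType) (n m p q : nat).
Variables (A : 'M[R]_n) (B : 'M[R]_(n, m)) (C : 'M[R]_(p, n)).

Lemma orbit_submanifold (K : 'M[R]_(m + q, p + q)) :
  stabilizing A B C K -> controllable (ctrlA K) (ctrlB K) ->
  embedded_submanifold (@controllers R m p q) (stabilizing A B C)
    (q ^ 2)%N (orbit_of K).
Proof.
move=> stK /exists_nice_selection[g gn uK].
have [s sg] := extend_to_perm (nice_selection_inj gn uK).
split; first by move=> _ [T uT <-]; exact: stabilizing_similarity.
(* This domain contains the whole orbit, so the same chart serves at every point of it. *)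
pose U := [set y : 'M[R]_(m + q, p + q) |
  stabilizing A B C y /\ ctrl_basis g y \in unitmx].
have Urel : relatively_open (@controllers R m p q) U.
  exists ([set y | stable (closed_loop A B C y)] `&`
          [set y | ctrl_basis g y \in unitmx]).
    apply: openI; [apply: open_stable|apply: open_unitmx].
    - by apply: smooth_closed_loop => //; exact: smooth_entries_id.
    - by apply: smooth_ctrl_basis => //; exact: smooth_entries_id.
  by apply/seteqP; split=> y /=; rewrite /U/stabilizing/=; tauto.
move=> x Ox; exists (m * q + q * p)%N, U, (chart g s K), (chart_inv g s K).
have Kc : controllers K by case: stK.
have phiK y : U y -> chart_inv g s K (chart g s K y) = y.
  by move=> [[yc _] uy]; exact: chartK.
pose W := [set v : 'rV[R]_(q ^ 2 + (m * q + q * p)) |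
  vec_mx (lsubmx v : 'rV_(q * q)) \in @unitmx R q].
(* Stability is invariant under similarity, so it is tested on the slice point, which is affine in
   [v]; openness of the image then follows from openness of stability and of invertibility. *)
pose O := [set v : 'rV[R]_(q ^ 2 + (m * q + q * p)) |
  stable (closed_loop A B C (slice s (coords s (normalize g K) + rsubmx v)))].
have imU : chart g s K @` U = O `&` W.
  apply/seteqP; split=> [_ [y [sty uy] <-]|v [Ov Wv]].
    split; last by rewrite /W/= row_mxKl mxvecK.
    rewrite /O/= row_mxKr addrC subrK coords_normalizeK//.
    have uVy : invmx (ctrl_basis g y) \in unitmx by rewrite unitmx_inv.
    by case: (stabilizing_similarity uVy sty).
  exists (chart_inv g s K v); last exact: chart_invK.
  split.
    exact: (stabilizing_similarity Wv (conj (controllers_slice _ _) Ov)).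
  by rewrite ctrl_basis_similarity// ctrl_basis_slice// mulmx1.
have sU : smooth_on (@controllers R m p q) U (chart g s K).
  have sid : smooth_entries (@controllers R m p q) U id.
    exact: smooth_entries_id.
  have lin := @controllers_lin R m p q.
  apply: smooth_on_mx => //; apply: smooth_entries_row_mx.
    by apply: smooth_entries_mxvec; exact: smooth_ctrl_basis.
  apply: smooth_entriesD => //; last exact: smooth_entries_cst.
  apply: smooth_coords; apply: smooth_normalize => //.
  by move=> y [].
have openO : open O.
  apply: open_stable; apply: smooth_closed_loop => //; apply: smooth_slice.
  apply: smooth_entriesD => //; first exact: smooth_entries_cst.
  by apply: smooth_entries_rsubmx; exact: smooth_entries_id.
have openW : open W.
  apply: open_unitmx; apply: smooth_entries_vec_mx.
  by apply: smooth_entries_lsubmx; exact: smooth_entries_id.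
have openOW : open (O `&` W) by exact: openI.
have sinv : smooth_on setT (O `&` W) (chart_inv g s K).
  have rel := relatively_openT openOW.
  have sid : smooth_entries setT (O `&` W) id by exact: smooth_entries_id.
  apply: smooth_on_mx => //; apply: smooth_similarity => //.
  - by move=> v [].
  - by apply: smooth_entries_vec_mx; exact: smooth_entries_lsubmx.
  - apply: smooth_slice; apply: smooth_entriesD => //.
      exact: smooth_entries_cst.
    exact: smooth_entries_rsubmx.
have slice_orbit y : U y -> (rsubmx (chart g s K y) = 0 <-> orbit_of K y).
  by move=> [[yc _] uy]; exact: chart_orbit.
split.
- case: Ox => T uT <-; split; first exact: stabilizing_similarity.
  by rewrite ctrl_basis_similarity// unitmx_mul; apply/andP.
- exact: Urel.
- by move=> y [].
- by split; rewrite ?imU.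
- by apply/seteqP; split=> y [Uy yS]; split=> //; exact/(slice_orbit y Uy).
Qed.

End OrbitManifold.

(** * Path components of the orbit *)

Section OrbitComponents.
Variables (R : realType) (m p q : nat).
Variable K : 'M[R]_(m + q, p + q).
Hypothesis ctrl_K : controllable (ctrlA K) (ctrlB K).

(* On the orbit, [T -> det (ctrl_basis (T . K))] is [det T] up to a nonzero
   constant; being continuous and nonvanishing, it keeps its sign on paths. *)
Lemma joined_orbit_sign (S T : 'M[R]_q) : S \in unitmx -> T \in unitmx ->
  joined_in R (orbit_of K) (similarity S K) (similarity T K) ->
  0 < \det S * \det T.
Proof.
have [g gn uK] := exists_nice_selection ctrl_K.
move=> uS uT [gamma [cg g0 g1 gO]].
pose f (y : 'M[R]_(m + q, p + q)) := \det (ctrl_basis g y).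
have fsim X : X \in unitmx -> f (similarity X K) = \det X * f K.
  by move=> uX; rewrite /f ctrl_basis_similarity// det_mulmx.
have detu X : X \in unitmx -> \det X != 0 :> R by rewrite unitmxE unitfE.
have fK0 : f K != 0 by exact: detu.
have cf : continuous f.
  apply: smooth_continuous; apply: smooth_on_det => //.
  by apply: smooth_ctrl_basis => //; exact: smooth_entries_id.
have cfg : {within `[0, 1], continuous (f \o gamma)}.
  by move=> x; exact: (cvg_comp _ _ (cg x) (cf (gamma x))).
(* Were the signs opposite, the intermediate value theorem would make [f] vanish at a point of the
   orbit, where it is a product of two nonzero numbers. *)
rewrite lt_neqAle eq_sym mulf_neq0 ?detu//= leNgt; apply/negP => ST.
have : Num.min ((f \o gamma) 0) ((f \o gamma) 1) <= 0
    <= Num.max ((f \o gamma) 0) ((f \o gamma) 1).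
  rewrite /= g0 g1 !fsim// ge_min le_max.
  have : (\det S * f K) * (\det T * f K) < 0.
    by rewrite mulrACA pmulr_llt0// -expr2 exprn_even_gt0.
  case: (ltgtP (\det S * f K) 0) => [a0|a0|->]; last by rewrite mul0r ltxx.
    by rewrite nmulr_rlt0//= => /ltW ->.
  by rewrite pmulr_rlt0//= => /ltW ->.
move=> /(IVT ler01 cfg)[t]; rewrite in_itv/= => /gO[X uX <-].
by rewrite /= fsim// => /eqP; apply/negP; rewrite mulf_neq0 ?detu.
Qed.

Lemma joined_orbit (S T : 'M[R]_q) : S \in unitmx -> T \in unitmx ->
  0 < \det S * \det T ->
  joined_in R (orbit_of K) (similarity S K) (similarity T K).
Proof.
move=> uS uT ST.
(* A path from the identity to [T *m invmx S] acts on [similarity S K]; its endpoint has positive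
   determinant, since multiplying by [\det S ^+ 2] gives [\det S * \det T]. *)
have [|gamma [sg g0 g1 gp]] := @pos_pathP R q (T *m invmx S).
  have S0 : \det S != 0 by rewrite -unitfE -unitmxE.
  rewrite det_mulmx det_inv -(pmulr_rgt0 _ (_ : 0 < \det S ^+ 2)).
    by rewrite expr2 -mulrA [X in _ * X]mulrCA mulfV// mulr1.
  by rewrite exprn_even_gt0.
have ug t : 0 <= t <= 1 -> gamma t *m S \in unitmx.
  move=> /gp gt0; rewrite unitmx_mul uS andbT unitmxE unitfE.
  exact: lt0r_neq0.
exists (fun t => similarity (gamma t *m S) K); split.
(* Outside the unit interval [gamma t *m S] may be singular, so smoothness is shown on the open set
   of good times, which contains the interval. *)
- pose U := [set t | gamma t *m S \in unitmx].
  have sgS : smooth_entries setT setT (fun t => gamma t *m S).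
    by apply: smooth_entries_mulmx => //; exact: smooth_entries_cst.
  have oU : open U := open_unitmx sgS.
  have U01 : `[0, 1]%classic `<=` U.
    by move=> t /=; rewrite in_itv/=; exact: ug.
  apply: continuous_subspaceW U01 _.
  have rU := relatively_openT oU.
  suff sm : smooth_on setT U (fun t => similarity (gamma t *m S) K).
    by case: (sm 0%N).
  apply: smooth_on_mx => //; apply: smooth_similarity => //.
    apply: smooth_entries_mulmx => //; last exact: smooth_entries_cst.
    by move=> i j; exact: smooth_on_subset (sg i j).
  exact: smooth_entries_cst.
- by rewrite g0 mul1mx.
- by rewrite g1 mulmxKV.
- by move=> t t01; exists (gamma t *m S) => //; exact: ug.
Qed.

Lemma path_component_orbit (S : 'M[R]_q) : S \in unitmx ->
  path_component_of R (orbit_of K) (similarity S K) =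
  [set similarity T K | T in [set T | T \in unitmx /\ 0 < \det S * \det T]].
Proof.
move=> uS; apply/seteqP; split=> [y Sy|_ [T [uT ST] <-]]; last first.
  exact: joined_orbit.
have [T uT Ty] : orbit_of K y.
  by case: Sy => gamma [_ _ <-]; apply; rewrite ler01 lexx.
by exists T => //; split=> //; apply: joined_orbit_sign => //; rewrite Ty.
Qed.

End OrbitComponents.

(** Flipping the sign of one coordinate, available as [q] is positive, shows that [orbit_neg] is
    nonempty. *)
Lemma exists_det_lt0 (R : realType) q : (0 < q)%N ->
  exists2 T : 'M[R]_q, T \in unitmx & \det T < 0.
Proof.
case: q => // q _; pose T : 'M[R]_(1 + q) := block_mx (-1)%:M 0 0 1%:M.
have detT : \det T = -1 by rewrite det_ublock det_scalar1 det1 mulr1.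
by exists T; rewrite ?unitmxE detT ?unitrN1// oppr_lt0.
Qed.

Theorem proposition4p1 (R : realType) (n m p : nat)
    (n_gt0 : (0 < n)%N) (m_gt0 : (0 < m)%N) (p_gt0 : (0 < p)%N)
    (A : 'M[R]_n) (B : 'M[R]_(n, m)) (C : 'M[R]_(p, n))
    (W : 'M[R]_n) (V : 'M[R]_p) (Q : 'M[R]_n) (Rc : 'M[R]_m)
    (W_psd : psdmx W) (V_pd : pdmx V) (Q_psd : psdmx Q) (Rc_pd : pdmx Rc)
    (ctrl_AB : controllable A B) (ctrl_AW : controllable A (sqrtmx W))
    (obs_CA : observable C A) (obs_QA : observable (sqrtmx Q) A)
    (q : nat) (q_gt0 : (0 < q)%N) (K : 'M[R]_(m + q, p + q))
    (K_stab : stabilizing A B C K)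
    (ctrl_K : controllable (ctrlA K) (ctrlB K))
    (obs_K : observable (ctrlC K) (ctrlA K)) :
  [/\ embedded_submanifold (@controllers R m p q) (stabilizing A B C)
        (q ^ 2)%N (orbit_of K),
      path_components R (orbit_of K) = [set orbit_pos K; orbit_neg K] &
      orbit_pos K <> orbit_neg K].
Proof.
have comp_pos S : S \in unitmx -> 0 < \det S ->
    path_component_of R (orbit_of K) (similarity S K) = orbit_pos K.
  move=> uS S0; rewrite path_component_orbit//.
  by congr image; apply/seteqP; split=> T [uT]; rewrite /= pmulr_rgt0.
have comp_neg S : S \in unitmx -> \det S < 0 ->
    path_component_of R (orbit_of K) (similarity S K) = orbit_neg K.
  move=> uS S0; rewrite path_component_orbit//.
  by congr image; apply/seteqP; split=> T [uT]; rewrite /= nmulr_rgt0.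
have [N uN N0] := exists_det_lt0 R q_gt0.
have det1_gt0 : 0 < \det (1%:M : 'M[R]_q) by rewrite det1.
split; first exact: orbit_submanifold.
- apply/seteqP; split=> [_ [_ [S uS <-] <-]|X [->|->]] /=.
  + have [S0|S0|S0] := ltgtP (\det S) 0.
    * by right; exact: comp_neg.
    * by left; exact: comp_pos.
    * by move: uS; rewrite /= unitmxE unitfE S0 eqxx.
  + exists (similarity 1%:M K); last exact: comp_pos (unitmx1 _ _) _.
    by exists 1%:M => //; exact: unitmx1.
  + by exists (similarity N K); [exists N|exact: comp_neg].
(* If the sets coincided, the same point would be [similarity 1%:M K] and [similarity T K] with
   [\det T < 0]; being joined to itself, it contradicts the sign invariant. *)
- move=> pn; have : orbit_pos K (similarity 1%:M K).
    by exists 1%:M => //; split=> //; exact: unitmx1.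
  rewrite pn => -[T [uT T0] T1].
  have u1 := unitmx1 R q.
  have : joined_in R (orbit_of K) (similarity 1%:M K) (similarity T K).
    by rewrite T1; apply: joined_orbit => //; rewrite det1 mulr1.
  by move=> /(joined_orbit_sign ctrl_K u1 uT); rewrite det1 mul1r ltNge ltW.
Qed.
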